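(* Let $n \ge 2$ be an integer, $\alpha,\beta\in\mathbb{R}$ with $\beta>0$ and $\alpha^2 < n\beta$, and let $\mathbb{M}_{\alpha,\beta} := \{M \in \mathbb{R}^{n\times n} : s(M) = n\alpha,\ q(M) = n\beta\}$. Let $M \in \mathbb{M}_{\alpha,\beta}$ be a matrix whose determinant is maximal among all elements of $\mathbb{M}_{\alpha,\beta}$ (such a matrix exists by compactness). Then: If $\alpha^2 \le \beta$: (A) $MM^T = \beta I$, and (B) $\det M = \beta^{n/2}$. If $\alpha^2 \ge \beta$: (C) every row sum and every column sum of $M$ equals $\alpha$; (D) $MM^T = (\beta-\delta)I + \delta J$, where $\delta := \frac{\alpha^2-\beta}{n-1}$ (so $\beta - \delta = \frac{n\beta-\alpha^2}{n-1}$); and (E) $\det M = |\alpha|(\beta-\delta)^{\frac{n-1}{2}}$.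
   Context: For a real matrix $M$, $s(M)$ denotes the sum of all entries of $M$ and $q(M)$ the sum of the squares of all entries of $M$. $I$ is the $n\times n$ identity matrix and $J$ is the $n\times n$ matrix with all entries equal to $1$. *)

(* Defs.v *)
From HB Require Import structures.
From mathcomp Require Import all_boot all_order all_algebra.
Set Implicit Arguments. Unset Strict Implicit. Unset Printing Implicit Defensive.
Import Order.TTheory GRing.Theory Num.Theory.
Local Open Scope ring_scope.

Definition msum (R : numDomainType) (n : nat) (M : 'M[R]_n) : R :=
  \sum_(i < n) \sum_(j < n) M i j.

Definition msq (R : numDomainType) (n : nat) (M : 'M[R]_n) : R :=
  \sum_(i < n) \sum_(j < n) M i j ^+ 2.

Definition onesmx (R : numDomainType) (n : nat) : 'M[R]_n := const_mx 1.

Definition mdelta (R : numFieldType) (n : nat) (alpha beta : R) : R :=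
  (alpha ^+ 2 - beta) / (n%:R - 1).

(* Main.v *)
Require Import Defs.
From HB Require Import structures.
From mathcomp Require Import all_boot all_order all_algebra all_fingroup.
From mathcomp Require Import complex ring lra.
Import Order.TTheory GRing.Theory Num.Theory.
Local Open Scope ring_scope.

(** Let N be an invertible matrix of the class with q(N^-1 M) <= n. The arithmetic-geometric
    mean inequality for the eigenvalues of X X^T, where X = N^-1 M, gives det(M)^2 <= det(N)^2,
    while maximality of M (and a swap of two rows, which only changes the sign of the
    determinant) gives |det N| <= det M. Equality in the mean inequality then forces
    X X^T = I, that is, M M^T = N N^T.
    If alpha^2 <= beta, take N = sqrt(beta) Q with Q = I - 2 a a^T a reflection whose unit
    vector a is chosen so that Q has entry sum n alpha / sqrt(beta).
    If alpha^2 >= beta, take N = g I + ((alpha - g) / n) J with g^2 = beta - delta; the bound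
    on q(N^-1 M) is Cauchy-Schwarz for the column sums of M, whose coefficient
    (alpha^-2 - g^-2) / n is nonpositive because g^2 <= beta <= alpha^2. *)

(** * The equality case of the mean inequality for a Gram matrix *)

(** The eigenvalues of the Hermitian Gram matrix are nonnegative, with mean at most 1 and product at
    least 1. The mean inequality squeezes both to 1 and makes all eigenvalues equal, hence equal to
    1. *)
Lemma unitarymx_AGM (C : numClosedFieldType) (n : nat) (Y : 'M[C]_n) :
  \tr (Y *m Y^t*%sesqui) <= n%:R -> 1 <= \det (Y *m Y^t*%sesqui) ->
  Y *m Y^t*%sesqui = 1%:M.
Proof.
set G := Y *m _ => trG detG.
have GH : G^t*%sesqui = G by rewrite /G trmx_mul map_mxM trmxCK.
have /orthomx_spectralP : G \is normalmx by apply/normalmxP; rewrite GH.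
set P := spectralmx G; set d := spectral_diag G => defG.
have uP : P \is unitarymx := spectral_unitarymx G.
have Pu : P \in unitmx := unitarymx_unit uP.
(* The diagonalised matrix is the Gram matrix of [P *m Y], so each eigenvalue is a sum of squared
   moduli. *)
have dE : diag_mx d = (P *m Y) *m (P *m Y)^t*%sesqui.
  rewrite trmx_mul map_mxM mulmxA -(mulmxA P) -/G -(invmx_unitary uP) {1}defG.
  by rewrite !mulmxA mulmxV // mul1mx mulmxK.
have d_ge0 i : 0 <= d 0 i.
  have -> : d 0 i = diag_mx d i i by rewrite mxE eqxx.
  rewrite dE mxE sumr_ge0 // => j _.
  by rewrite !mxE -normCK exprn_ge0.
have trE : \tr G = \sum_i d 0 i.
  by rewrite defG mxtrace_mulC mulmxA mulmxV // mul1mx mxtrace_diag.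
have detE : \det G = \prod_i d 0 i.
  by rewrite defG !det_mulmx mulrC mulrA -det_mulmx mulmxV // det1 mul1r det_diag.
have /= := @leif_AGM C 'I_n predT (fun i => d 0 i) (fun i _ => d_ge0 i).
rewrite -detE -trE card_ord => -[le_AGM eq_AGM].
have mean_ge0 : 0 <= \tr G / n%:R by rewrite divr_ge0 ?ler0n // trE sumr_ge0.
have mean_le1 : \tr G / n%:R <= 1.
  (* For n = 0 the mean is 0, since the inverse of 0 is 0. *)
  have [n0|n_gt0] := posnP n; first by rewrite {2}n0 invr0 mulr0 ler01.
  by rewrite ler_pdivrMr ?ltr0n // mul1r.
have meanX_le1 : (\tr G / n%:R) ^+ n <= 1 by rewrite exprn_ile1.
have detG1 : \det G = 1 by apply/le_anti; rewrite detG (le_trans le_AGM).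
have meanX1 : (\tr G / n%:R) ^+ n = 1.
  by apply/le_anti; rewrite meanX_le1 -{1}detG1.
move: eq_AGM; rewrite detG1 meanX1 eqxx => /esym/forall_inP d_const.
suff d1 : d = const_mx 1 by rewrite defG d1 diag_const_mx mulmx1 mulVmx.
apply/rowP => i; rewrite mxE; apply/eqP.
have n_gt0 : (0 < n)%N by apply: leq_ltn_trans (ltn_ord i).
rewrite -(@pexpr_eq1 _ _ n) // -[X in _ == X]detG1 detE.
rewrite (eq_bigr (fun=> d 0 i)) ?prodr_const ?card_ord // => j _.
by apply/eqP; rewrite eq_sym; have /forall_inP/(_ j isT) := d_const i isT.
Qed.

Lemma msqE (R : numDomainType) (n : nat) (M : 'M[R]_n) : msq M = \tr (M *m M^T).
Proof.
by apply: eq_bigr => i _; rewrite mxE; apply: eq_bigr => j _; rewrite mxE expr2.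
Qed.

(** Embedding R into its complex extension makes the spectral theorem available; on real matrices
    the conjugate transpose is the transpose. *)
Lemma mulmx_tr_AGM (R : rcfType) (n : nat) (X : 'M[R]_n) :
  msq X <= n%:R -> 1 <= \det X ^+ 2 -> X *m X^T = 1%:M.
Proof.
rewrite msqE => trX detX; pose f := real_complex R.
have fXH : (map_mx f X)^t*%sesqui = map_mx f X^T.
  by apply/matrixP => i j; rewrite !mxE conj_Creal // complex_real.
apply: (map_mx_inj (f := f)); rewrite map_mx1 map_mxM -fXH.
apply: unitarymx_AGM; rewrite fXH -map_mxM.
  by rewrite trace_map_mx -(rmorph_nat f) lecR.
by rewrite det_map_mx det_mulmx det_tr -expr2 -(rmorph1 f) lecR.
Qed.

(** * Comparing the maximiser with another matrix of the class *)

Lemma normr_det_le_max (R : rcfType) (n : nat) (s q d : R) :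
  (1 < n)%N ->
  (forall N : 'M[R]_n, msum N = s -> msq N = q -> \det N <= d) ->
  forall N : 'M[R]_n, msum N = s -> msq N = q -> `|\det N| <= d.
Proof.
case: n => [|[|n]] // _ max_d N sN qN.
rewrite ler_norml lerNl max_d // andbT.
(* With at least two indices, [ord0] and [ord_max] differ, so this transposition is odd. *)
pose t : 'S_n.+2 := tperm ord0 ord_max.
have <- : \det (row_perm t N) = - \det N.
  by rewrite row_permE det_mulmx det_perm odd_tperm expr1 mulN1r.
apply: max_d.
- rewrite -sN [RHS](reindex_inj (@perm_inj _ t)); apply: eq_bigr => i _.
  by apply: eq_bigr => j _; rewrite mxE.
- rewrite -qN [RHS](reindex_inj (@perm_inj _ t)); apply: eq_bigr => i _.
  by apply: eq_bigr => j _; rewrite mxE.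
Qed.

(** Reduces each case of the theorem to exhibiting a suitable N. For X = N^-1 M, the relations det M
    = det N det X and |det N| <= det M give det(X)^2 >= 1, as [mulmx_tr_AGM] requires. *)
Lemma max_det_gram (R : rcfType) (n : nat) (s q : R) (M N : 'M[R]_n) :
  (1 < n)%N ->
  (forall K : 'M[R]_n, msum K = s -> msq K = q -> \det K <= \det M) ->
  msum N = s -> msq N = q -> N \in unitmx -> msq (invmx N *m M) <= n%:R ->
  \det M = `|\det N| /\ M *m M^T = N *m N^T.
Proof.
move=> n_gt1 maxM sN qN Nu qNM.
have detNM : `|\det N| <= \det M by apply: normr_det_le_max sN qN.
have detN_neq0 : \det N != 0 by rewrite -unitfE -unitmxE.
have detM_ge0 : 0 <= \det M := le_trans (normr_ge0 _) detNM.
have detM2 : \det M ^+ 2 = \det N ^+ 2 * \det (invmx N *m M) ^+ 2.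
  by rewrite -exprMn -det_mulmx mulKVmx.
have orthX : (invmx N *m M) *m (invmx N *m M)^T = 1%:M.
  apply: mulmx_tr_AGM => //.
  rewrite -(ler_pM2l (_ : 0 < \det N ^+ 2)) ?exprn_even_gt0 //.
  by rewrite -detM2 mulr1 -[X in X <= _]real_normK ?num_real // ler_sqr ?nnegrE.
split.
  have := congr1 determinant orthX; rewrite det_mulmx det_tr det1 -expr2 => detX.
  move: detM2; rewrite detX mulr1 -[RHS]real_normK ?num_real //.
  by move/eqP; rewrite eqrXn2 // => /eqP.
have -> : M = N *m (invmx N *m M) by rewrite mulKVmx.
by rewrite trmx_mul mulmxA -(mulmxA N) orthX mulmx1.
Qed.

(** * Products and determinants of the matrices a I + b J *)

Lemma det_1_add_mulmx (R : comNzRingType) (n m : nat)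
    (A : 'M[R]_(n, m)) (B : 'M[R]_(m, n)) :
  \det (1%:M + A *m B) = \det (1%:M + B *m A).
Proof.
(* K factors both as lower * upper and as upper * lower block triangular. *)
pose K := block_mx (1%:M : 'M[R]_m) (- B) A (1%:M : 'M[R]_n).
have KE1 : K = block_mx 1%:M 0 A 1%:M *m block_mx 1%:M (- B) 0 (1%:M + A *m B).
  rewrite mulmx_block !(mul1mx, mul0mx, mulmx1, addr0) mulmxN addrC.
  by rewrite addrK.
have KE2 : K = block_mx (1%:M + B *m A) (- B) 0 1%:M *m block_mx 1%:M 0 A 1%:M.
  by rewrite mulmx_block !(mul1mx, mul0mx, mulmx1, mulmx0, add0r) mulNmx addrK.
have := congr1 determinant KE1; rewrite {1}KE2.
by rewrite !det_mulmx !det_lblock !det_ublock !det1 !mul1r !mulr1 => ->.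
Qed.

Lemma onesmxE (R : numDomainType) (n : nat) :
  onesmx R n = (const_mx 1 : 'cV_n) *m (const_mx 1 : 'rV_n).
Proof. by apply/matrixP => i j; rewrite !mxE big_ord1 !mxE mulr1. Qed.

Lemma mulmx_onesmxl (R : numDomainType) (n : nat) (A : 'M[R]_n) i j :
  (onesmx R n *m A) i j = \sum_k A k j.
Proof. by rewrite mxE; apply: eq_bigr => k _; rewrite mxE mul1r. Qed.

Lemma mxtrace_onesmx_mul (R : numDomainType) (n : nat) (A : 'M[R]_n) :
  \tr (onesmx R n *m A) = msum A.
Proof. by rewrite /msum exchange_big; apply: eq_bigr => i _; rewrite mulmx_onesmxl. Qed.

Lemma row_sum_scalarD_onesmx (R : numDomainType) (n : nat) (a b : R) (i : 'I_n) :
  \sum_j (a%:M + b *: onesmx R n) i j = a + n%:R * b.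
Proof.
rewrite (eq_bigr (fun j => a *+ (i == j) + b)); last first.
  by move=> j _; rewrite !mxE mulr1.
rewrite big_split /= sumr_const card_ord -[b *+ n]mulr_natl (bigD1 i) //= eqxx mulr1n.
by rewrite big1 ?addr0 // => j /negPf; rewrite eq_sym => ->.
Qed.

Lemma msum_scalarD_onesmx (R : numDomainType) (n : nat) (a b : R) :
  msum (a%:M + b *: onesmx R n) = n%:R * (a + n%:R * b).
Proof.
rewrite /msum (eq_bigr (fun=> a + n%:R * b)) => [|i _].
  by rewrite sumr_const card_ord -[LHS]mulr_natl.
exact: row_sum_scalarD_onesmx.
Qed.

(** Since J^2 = n J, the span of I and J is closed under products; the second case of the theorem
    computes N N^T and N^-1 inside it. *)
Lemma mul_scalarD_onesmx (R : numDomainType) (n : nat) (a b c d : R) :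
  (a%:M + b *: onesmx R n) *m (c%:M + d *: onesmx R n) =
  (a * c)%:M + (a * d + b * c + n%:R * b * d) *: onesmx R n.
Proof.
have JJ : onesmx R n *m onesmx R n = n%:R *: onesmx R n.
  apply/matrixP => i j; rewrite mulmx_onesmxl !mxE mulr1.
  by rewrite (eq_bigr (fun=> 1)) ?sumr_const ?card_ord // => k _; rewrite mxE.
rewrite mulmxDl !mulmxDr -!scalar_mxM !mul_scalar_mx !mul_mx_scalar.
rewrite -!scalemxAl -scalemxAr JJ !scalerA -!addrA; congr (_ + _).
by rewrite -!scalerDl; congr (_ *: _); ring.
Qed.

Lemma tr_scalarD_onesmx (R : numDomainType) (n : nat) (a b : R) :
  (a%:M + b *: onesmx R n)^T = a%:M + b *: onesmx R n.
Proof. by rewrite linearD linearZ /= tr_scalar_mx trmx_const. Qed.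

(** Up to the factor a this is I plus a rank-one matrix, and [det_1_add_mulmx] turns its determinant
    into that of the 1 x 1 matrix 1 + n b / a. *)
Lemma det_scalarD_onesmx (R : numFieldType) (n : nat) (a b : R) :
  (0 < n)%N -> a != 0 ->
  \det (a%:M + b *: onesmx R n) = a ^+ n.-1 * (a + n%:R * b).
Proof.
case: n => // n _ a_neq0.
have -> : a%:M + b *: onesmx R n.+1 =
    a *: (1%:M + (const_mx (b / a) : 'cV_n.+1) *m (const_mx 1 : 'rV_n.+1)).
  apply/matrixP => i j; rewrite !mxE big_ord1 !mxE.
  by case: (i == j); field.
rewrite detZ det_1_add_mulmx [X in \det X]mx11_scalar det_scalar1 !mxE /=.
rewrite (eq_bigr (fun=> b / a)); last by move=> i _; rewrite !mxE mul1r.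
by rewrite sumr_const card_ord -mulr_natl exprSr; field.
Qed.

(** * Squares of column sums *)

(** With e the all-ones vector, both sides are the squared norm of M^T e, whose entries are the
    column sums. *)
Lemma msum_mul_tr (R : numDomainType) (n : nat) (M : 'M[R]_n) :
  msum (M *m M^T) = \sum_j (\sum_i M i j) ^+ 2.
Proof.
rewrite /msum (eq_bigr (fun i => \sum_k M i k * \sum_j M j k)); last first.
  move=> i _; rewrite (eq_bigr (fun j => \sum_k M i k * M j k)); last first.
    by move=> j _; rewrite mxE; apply: eq_bigr => k _; rewrite mxE.
  by rewrite exchange_big; apply: eq_bigr => k _; rewrite mulr_sumr.
by rewrite exchange_big; apply: eq_bigr => k _; rewrite -mulr_suml expr2.
Qed.

(** The variance identity serves twice for column sums: its nonnegativity is the Cauchy-Schwarz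
    bound, and its vanishing forces every sum to equal the mean. *)
Lemma sum_sqr_dev (R : numDomainType) (n : nat) (c : 'I_n -> R) (a : R) :
  \sum_i c i = n%:R * a ->
  \sum_i (c i - a) ^+ 2 = \sum_i c i ^+ 2 - n%:R * a ^+ 2.
Proof.
move=> sum_c; rewrite (eq_bigr (fun i => c i ^+ 2 - (c i * (2 * a) - a ^+ 2))).
  rewrite !sumrB -mulr_suml sum_c sumr_const card_ord -mulr_natl; ring.
by move=> i _; ring.
Qed.

(** * Reflections with prescribed entry sum *)

Lemma exists_unit_vector_sum (R : rcfType) (n : nat) (s : R) :
  (1 < n)%N -> 0 <= s <= n%:R ->
  exists a : 'I_n -> R, \sum_i a i ^+ 2 = 1 /\ (\sum_i a i) ^+ 2 = s.
Proof.
case: n => [|[|n]] // _ /andP[s_ge0 s_le].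
have n_gt0 : 0 < n.+2%:R :> R by rewrite ltr0n.
have nE : n.+2%:R = n%:R + 2 :> R by rewrite -addn2 natrD.
have q_ge0 : 0 <= (1 - s / n.+2%:R) / 2.
  by rewrite divr_ge0 // subr_ge0 ler_pdivrMr ?mul1r.
pose p := Num.sqrt s / n.+2%:R; pose q := Num.sqrt ((1 - s / n.+2%:R) / 2).
have p2 : p ^+ 2 = s / n.+2%:R ^+ 2 by rewrite exprMn sqr_sqrtr // exprVn.
have q2 : q ^+ 2 = (1 - s / n.+2%:R) / 2 by rewrite sqr_sqrtr.
(* a = p (1,...,1) + q (e_0 - e_max) has sum n p and square norm n p^2 + 2 q^2. *)
exists (fun i => p + q * (i == ord0)%:R - q * (i == ord_max)%:R).
have mid (i : 'I_n) : p + q * (lift ord0 (widen_ord (leqnSn n) i) == ord0)%:R -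
    q * (lift ord0 (widen_ord (leqnSn n) i) == ord_max)%:R = p.
  have -> : (lift ord0 (widen_ord (leqnSn n) i) == ord_max) = false.
    apply/eqP => /(congr1 val) /=; rewrite /bump /= => -[] ni.
    by have := ltn_ord i; rewrite [X in (X < _)%N]ni ltnn.
  by rewrite !mulr0 subr0 addr0.
split; rewrite big_ord_recl big_ord_recr /=.
  rewrite (eq_bigr (fun=> p ^+ 2)) => [|i _]; last by rewrite mid.
  rewrite sumr_const card_ord -mulr_natl /= ?eqxx /=.
  have -> : (lift ord0 (@ord_max n) == ord_max) by apply/eqP/val_inj.
  rewrite !mulr0 !mulr1 !subr0 !addr0.
  transitivity (n.+2%:R * p ^+ 2 + 2 * q ^+ 2); first by rewrite nE; ring.
  by rewrite p2 q2; field; rewrite -natrD pnatr_eq0.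
rewrite (eq_bigr (fun=> p)) => [|i _]; last by rewrite mid.
rewrite sumr_const card_ord -mulr_natl /= ?eqxx /=.
have -> : (lift ord0 (@ord_max n) == ord_max) by apply/eqP/val_inj.
rewrite !mulr0 !mulr1 !subr0 !addr0.
transitivity (n.+2%:R ^+ 2 * p ^+ 2); first by rewrite nE; ring.
by rewrite p2; field; rewrite -natrD pnatr_eq0.
Qed.

(** The reflection I - 2 a a^T has entry sum n - 2 t, where t is the squared sum of a. As t runs
    through [0, n] this covers [-n, n]; t = (n - s) / 2 gives s. *)
Lemma exists_orthogonal_msum (R : rcfType) (n : nat) (s : R) :
  (1 < n)%N -> `|s| <= n%:R ->
  exists Q : 'M[R]_n, Q *m Q^T = 1%:M /\ msum Q = s.
Proof.
move=> n_gt1; rewrite ler_norml => /andP[s_ge s_le].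
have [|a [a2 sa]] := @exists_unit_vector_sum R n ((n%:R - s) / 2) n_gt1.
  by apply/andP; split; lra.
pose v : 'cV_n := \col_i a i; exists (1%:M - 2 *: (v *m v^T)); split.
  have vv : v^T *m v = 1%:M.
    apply/matrixP => i j; rewrite !ord1 !mxE eqxx -[RHS]a2.
    by apply: eq_bigr => k _; rewrite !mxE expr2.
  have -> : (1%:M - 2 *: (v *m v^T))^T = 1%:M - 2 *: (v *m v^T).
    by rewrite linearB linearZ /= trmx1 trmx_mul trmxK.
  rewrite mulmxBl mul1mx mulmxBr mulmx1.
  rewrite -scalemxAl -scalemxAr mulmxA -(mulmxA v) vv mulmx1 scalerA.
  by apply/matrixP => i j; move: (v *m v^T) => V; rewrite !mxE; ring.
have -> : 1%:M - 2 *: (v *m v^T) = 1%:M + 0 *: onesmx R n - 2 *: (v *m v^T).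
  by rewrite scale0r addr0.
transitivity (n%:R - 2 * (\sum_i a i) ^+ 2); last by rewrite sa; field.
rewrite -(_ : msum (v *m v^T) = (\sum_i a i) ^+ 2); last first.
  rewrite /msum expr2 mulr_suml; apply: eq_bigr => i _; rewrite mulr_sumr.
  by apply: eq_bigr => j _; rewrite !mxE big_ord1 !mxE.
have -> : n%:R = msum (1%:M + 0 *: onesmx R n).
  by rewrite msum_scalarD_onesmx mulr0 addr0 mulr1.
rewrite /msum mulr_sumr -sumrB; apply: eq_bigr => i _.
by rewrite mulr_sumr -sumrB; apply: eq_bigr => j _; rewrite !mxE.
Qed.

(** * The choice of N in the two ranges of alpha^2 *)

Theorem mainTheorem4 (R : rcfType) (n : nat) (alpha beta : R) (M : 'M[R]_n) :
  (2 <= n)%N -> 0 < beta -> alpha ^+ 2 < n%:R * beta ->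
  msum M = n%:R * alpha -> msq M = n%:R * beta ->
  (forall N : 'M[R]_n, msum N = n%:R * alpha -> msq N = n%:R * beta ->
     \det N <= \det M) ->
  (alpha ^+ 2 <= beta ->
     M *m M^T = beta%:M /\ \det M = Num.sqrt beta ^+ n) /\
  (beta <= alpha ^+ 2 ->
     (forall i : 'I_n, \sum_(j < n) M i j = alpha) /\
     (forall j : 'I_n, \sum_(i < n) M i j = alpha) /\
     M *m M^T = (beta - mdelta n alpha beta)%:M + mdelta n alpha beta *: onesmx R n /\
     \det M = `|alpha| * Num.sqrt (beta - mdelta n alpha beta) ^+ n.-1).
Proof.
move=> n_gt1 beta_gt0 lt_ab sM qM maxM.
have n_gt0 : 0 < n%:R :> R by rewrite ltr0n ltnW.
split=> [le_ab | le_ba].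
  have sb_gt0 : 0 < Num.sqrt beta by rewrite sqrtr_gt0.
  have sb2 : Num.sqrt beta ^+ 2 = beta by rewrite sqr_sqrtr ?ltW.
  (* The prescribed sum is admissible because |alpha| <= sqrt(beta). *)
  have [|Q [QQ sQ]] := @exists_orthogonal_msum R n (n%:R * (alpha / Num.sqrt beta)) n_gt1.
    rewrite normrM normr_nat ger_pMr // normrM normfV.
    rewrite [X in _ / X]gtr0_norm // ler_pdivrMr // mul1r.
    by rewrite -sqrtr_sqr ler_wsqrtr.
  pose N := Num.sqrt beta *: Q.
  have NN : N *m N^T = beta%:M.
    by rewrite linearZ /= -scalemxAl -scalemxAr scalerA -expr2 sb2 QQ scalemx1.
  have qN : msq N = n%:R * beta by rewrite msqE NN mxtrace_scalar mulr_natl.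
  have sN : msum N = n%:R * alpha.
    transitivity (Num.sqrt beta * msum Q); last by rewrite sQ; field; rewrite gt_eqF.
    rewrite /msum mulr_sumr; apply: eq_bigr => i _; rewrite mulr_sumr.
    by apply: eq_bigr => j _; rewrite !mxE.
  have NV : N *m (beta^-1 *: N^T) = 1%:M.
    by rewrite -scalemxAr NN scale_scalar_mx mulVf ?gt_eqF.
  have [Nu _] := mulmx1_unit NV.
  have NVE : invmx N = beta^-1 *: N^T.
    by rewrite -[LHS]mulmx1 -NV mulmxA mulVmx // mul1mx.
  (* As N^-1 is an orthogonal matrix divided by sqrt(beta), q(N^-1 M) = q(M) / beta = n. *)
  have qNM : msq (invmx N *m M) <= n%:R.
    have XE : invmx N *m M = beta^-1 *: (N^T *m M) by rewrite NVE -scalemxAl.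
    have XT : (beta^-1 *: (N^T *m M))^T = beta^-1 *: (M^T *m N).
      by rewrite linearZ /= trmx_mul trmxK.
    rewrite msqE XE XT -scalemxAl -scalemxAr !mxtraceZ mxtrace_mulC mulmxA.
    rewrite -(mulmxA M^T) NN mul_mx_scalar -scalemxAl mxtraceZ mxtrace_mulC.
    by rewrite -msqE qM le_eqVlt; apply/orP; left; apply/eqP; field; rewrite gt_eqF.
  have [detM MM] := max_det_gram _ _ _ _ _ _ n_gt1 maxM sN qN Nu qNM.
  split; first by rewrite MM.
  rewrite detM.
  apply/eqP; rewrite -(@eqrXn2 _ 2) ?exprn_ge0 ?sqrtr_ge0 //.
  rewrite real_normK ?num_real // exprAC sb2 expr2 -{2}det_tr -det_mulmx NN.
  by rewrite det_scalar.
set delta := mdelta n alpha beta.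
pose g := Num.sqrt (beta - delta).
have n1_gt0 : 0 < n%:R - 1 :> R by rewrite subr_gt0 ltr1n.
have gE : beta - delta = (n%:R * beta - alpha ^+ 2) / (n%:R - 1).
  by rewrite /delta /mdelta; field; rewrite gt_eqF.
have gd_gt0 : 0 < beta - delta by rewrite gE divr_gt0 // subr_gt0.
have g_gt0 : 0 < g by rewrite sqrtr_gt0.
have g2 : g ^+ 2 = beta - delta by rewrite sqr_sqrtr ?ltW.
have a2_gt0 : 0 < alpha ^+ 2 := lt_le_trans beta_gt0 le_ba.
have alpha_neq0 : alpha != 0 by rewrite -sqrf_eq0 gt_eqF.
(* This is the eigenvalue of (beta - delta) I + delta J on the all-ones vector. *)
have dE : beta - delta + n%:R * delta = alpha ^+ 2.
  by rewrite /delta /mdelta; field; rewrite gt_eqF.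
have delta_ge0 : 0 <= delta by rewrite divr_ge0 ?(ltW n1_gt0) // subr_ge0.
have le_g2a2 : g ^+ 2 <= alpha ^+ 2 by rewrite g2; lra.
(* N multiplies the all-ones vector by alpha and its orthogonal complement by g; [NI] has the
   inverse eigenvalues. *)
pose N := g%:M + ((alpha - g) / n%:R) *: onesmx R n.
pose NI := g^-1%:M + ((alpha^-1 - g^-1) / n%:R) *: onesmx R n.
have NN : N *m N^T = (beta - delta)%:M + delta *: onesmx R n.
  rewrite tr_scalarD_onesmx mul_scalarD_onesmx -expr2 g2; congr (_ + _ *: _).
  apply: (mulfI (lt0r_neq0 n_gt0)); rewrite -[RHS](addKr (beta - delta)) dE -g2.
  by field; rewrite gt_eqF.
have sN : msum N = n%:R * alpha by rewrite msum_scalarD_onesmx; field; rewrite gt_eqF.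
have trJ : \tr (onesmx R n) = n%:R.
  by rewrite /mxtrace (eq_bigr (fun=> 1)) ?sumr_const ?card_ord // => i _; rewrite mxE.
have qN : msq N = n%:R * beta.
  by rewrite msqE NN linearD linearZ /= trJ mxtrace_scalar -mulr_natl; ring.
have NNI : N *m NI = 1%:M.
  rewrite mul_scalarD_onesmx mulfV ?gt_eqF // -[RHS]addr0; congr (_ + _).
  rewrite -[RHS](scale0r (onesmx R n)); congr (_ *: _).
  by field; rewrite alpha_neq0 !gt_eqF.
have [Nu _] := mulmx1_unit NNI.
have NVE : invmx N = NI by rewrite -[LHS]mulmx1 -NNI mulmxA mulVmx // mul1mx.
have sMM_ge : n%:R * alpha ^+ 2 <= msum (M *m M^T).
  rewrite -subr_ge0 msum_mul_tr -sum_sqr_dev ?sumr_ge0 // => [i _|].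
    by rewrite sqr_ge0.
  by rewrite exchange_big.
have qNM : msq (invmx N *m M) <= n%:R.
  (* By cyclicity this is the trace of [NI *m NI] times M M^T; the J part of [NI *m NI] picks out
     the entry sum. *)
  have -> : msq (invmx N *m M) =
      (g ^+ 2)^-1 * (n%:R * beta) +
      ((alpha ^+ 2)^-1 - (g ^+ 2)^-1) / n%:R * msum (M *m M^T).
    rewrite msqE trmx_mul NVE tr_scalarD_onesmx -/NI mulmxA mxtrace_mulC !mulmxA.
    rewrite mul_scalarD_onesmx -mulmxA mulmxDl mul_scalar_mx -scalemxAl.
    rewrite linearD !linearZ /= mxtrace_onesmx_mul -msqE qM.
    congr (_ * _ + _ * _); first by rewrite -expr2 exprVn.
    by field; rewrite alpha_neq0 !gt_eqF.
  have coef_le0 : ((alpha ^+ 2)^-1 - (g ^+ 2)^-1) / n%:R <= 0.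
    by rewrite pmulr_lle0 ?invr_gt0 // subr_le0 lef_pV2 ?posrE ?a2_gt0 ?exprn_gt0.
  apply: le_trans (lerD (lexx _) (ler_wnM2l coef_le0 sMM_ge)) _.
  (* The bound equals (n beta - alpha^2) / g^2 + 1 = (n - 1) + 1. *)
  rewrite le_eqVlt; apply/orP; left; apply/eqP.
  rewrite g2 gE; field.
  by rewrite alpha_neq0 !gt_eqF // subr_gt0.
have [detM MM] := max_det_gram _ _ _ _ _ _ n_gt1 maxM sN qN Nu qNM.
rewrite NN in MM.
(* The known Gram matrix has entry sum n alpha^2, which is equality in Cauchy-Schwarz for the column
   sums. *)
have col_sum j : \sum_(i < n) M i j = alpha.
  have : \sum_j (\sum_i M i j - alpha) ^+ 2 = 0.
    rewrite sum_sqr_dev; last by rewrite exchange_big.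
    by rewrite -msum_mul_tr MM msum_scalarD_onesmx dE subrr.
  move/psumr_eq0P => /(_ (fun j _ => sqr_ge0 _))/(_ j isT)/eqP.
  by rewrite sqrf_eq0 subr_eq0 => /eqP.
split; last split => //; last split => //.
  (* With e the all-ones vector, M^T e = alpha e and M M^T e = alpha^2 e give alpha M e = alpha^2 e;
     then alpha cancels. *)
  move=> i; apply: (mulfI alpha_neq0).
  transitivity (\sum_j (M *m M^T) i j).
    transitivity (\sum_k M i k * \sum_j M j k).
      by rewrite mulr_sumr; apply: eq_bigr => k _; rewrite col_sum mulrC.
    rewrite (eq_bigr (fun k => \sum_j M i k * M j k)) => [|k _]; last first.
      by rewrite mulr_sumr.
    rewrite exchange_big; apply: eq_bigr => j _; rewrite mxE.
    by apply: eq_bigr => k _; rewrite mxE.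
  by rewrite MM row_sum_scalarD_onesmx dE expr2.
rewrite detM det_scalarD_onesmx ?gt_eqF // 1?ltnW //.
rewrite (_ : g + _ = alpha); last by field; rewrite gt_eqF.
by rewrite normrM normrX [`|g|]gtr0_norm // mulrC.
Qed.
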